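(* Let $p$ be a prime number and $G=\{1,\alpha,\dots,\alpha^{p-1}\}$ a cyclic group of order $p$. Let $0\neq f\in\mathbb{C}^G\cong\mathbb{C}G$, and let $\tilde f(z)=\sum_{i=0}^{p-1}f(\alpha^i)z^i\in\mathbb{C}[z]$. Then $$|\mathrm{supp}(f)|+\dim\mathbb{C}Gf\;\ge\;p+1,$$ with equality if and only if $\deg\big(\gcd(\tilde f(z),z^p-1)\big)=|\mathrm{supp}(f)|-1$.
   Context: $\mathbb{C}^G$ is the space of functions $G\to\mathbb{C}$, identified with the group algebra $\mathbb{C}G$ via $f\mapsto\sum_{x\in G}f(x)x$. $\mathbb{C}Gf$ is the left ideal of $\mathbb{C}G$ generated by $f$, and $\dim$ is its complex dimension. $\mathrm{supp}(f)=\{x\in G:f(x)\ne0\}$. The gcd is taken in $\mathbb{C}[z]$. *)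

(* Defs.v *)
From HB Require Import structures.
From mathcomp Require Import all_boot all_order all_algebra all_fingroup.
From mathcomp Require Import all_field.
From mathcomp Require Export reals complex.

Set Implicit Arguments.
Unset Strict Implicit.
Unset Printing Implicit Defensive.

Import GRing.Theory.
Local Open Scope ring_scope.

(* The group algebra F[gT], carried by the functions gT -> F, where f stands   *)
(* for the formal sum of the f x . x. It is a separate type because {ffun _}   *)
(* already has the pointwise product; here the product is convolution.         *)
Definition galg (F : fieldType) (gT : finGroupType) : Type := {ffun gT -> F^o}.

Section GroupAlgebra.
Variables (F : fieldType) (gT : finGroupType).
Local Notation A := (galg F gT).
Implicit Types f g h : A.

Definition galg_fun f : gT -> F := fun x => fun_of_fin f x.

HB.instance Definition _ := Vector.copy A {ffun gT -> F^o}.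

Definition galg_one : A := [ffun x : gT => (x == 1%g)%:R : F^o].

Definition galg_mul f g : A :=
  [ffun x : gT => (\sum_(y : gT) galg_fun f y * galg_fun g (y^-1 * x)%g) : F^o].

Lemma galg_oneE x : galg_fun galg_one x = (x == 1%g)%:R.
Proof. by rewrite /galg_fun ffunE. Qed.

Lemma galg_mulE f g x :
  galg_fun (galg_mul f g) x =
    \sum_(y : gT) galg_fun f y * galg_fun g (y^-1 * x)%g.
Proof. by rewrite /galg_fun ffunE. Qed.

Lemma galg_addE f g x : galg_fun (f + g) x = galg_fun f x + galg_fun g x.
Proof. by rewrite /galg_fun ffunE. Qed.

Lemma galg_scaleE a f x : galg_fun (a *: f) x = a * galg_fun f x.
Proof. by rewrite /galg_fun ffunE. Qed.

Lemma galg_zeroE x : galg_fun (0 : A) x = 0.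
Proof. by rewrite /galg_fun ffunE. Qed.

Lemma galgP f g : galg_fun f =1 galg_fun g -> f = g.
Proof. by move=> fg; apply/ffunP => x; apply: fg. Qed.

Fact galg_mulA : associative galg_mul.
Proof.
move=> f g h; apply: galgP => x; rewrite !galg_mulE.
under eq_bigr => y _ do rewrite galg_mulE big_distrr /=.
under [RHS]eq_bigr => y _ do rewrite galg_mulE big_distrl /=.
rewrite [RHS]exchange_big /=; apply: eq_bigr => y _.
rewrite [RHS](reindex_inj (mulgI y)) /=; apply: eq_bigr => z _.
by rewrite mulKg invMg !mulgA mulrA.
Qed.

Fact galg_mul1 : left_id galg_one galg_mul.
Proof.
move=> f; apply: galgP => x; rewrite galg_mulE (bigD1 1%g) //= galg_oneE.
rewrite eqxx mul1r invg1 mul1g big1 ?addr0 // => y /negPf y1.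
by rewrite galg_oneE y1 mul0r.
Qed.

Fact galg_mulr1 : right_id galg_one galg_mul.
Proof.
move=> f; apply: galgP => x; rewrite galg_mulE (bigD1 x) //= galg_oneE.
rewrite mulVg eqxx mulr1 big1 ?addr0 // => y yx.
by rewrite galg_oneE -eq_mulVg1 (negPf yx) mulr0.
Qed.

Fact galg_mulDl : left_distributive galg_mul +%R.
Proof.
move=> f g h; apply: galgP => x; rewrite galg_addE !galg_mulE -big_split /=.
by apply: eq_bigr => y _; rewrite galg_addE mulrDl.
Qed.

Fact galg_mulDr : right_distributive galg_mul +%R.
Proof.
move=> f g h; apply: galgP => x; rewrite galg_addE !galg_mulE -big_split /=.
by apply: eq_bigr => y _; rewrite galg_addE mulrDr.
Qed.

Fact galg_one_neq0 : galg_one != 0.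
Proof.
apply/eqP => /(congr1 (fun f => galg_fun f 1%g)) /eqP.
by rewrite galg_oneE galg_zeroE eqxx oner_eq0.
Qed.

HB.instance Definition _ := GRing.Zmodule_isNzRing.Build A
  galg_mulA galg_mul1 galg_mulr1 galg_mulDl galg_mulDr galg_one_neq0.

Fact galg_scaleAl (a : F) f g : a *: (f * g) = (a *: f) * g.
Proof.
apply: galgP => x; rewrite galg_scaleE !galg_mulE mulr_sumr.
by apply: eq_bigr => y _; rewrite galg_scaleE mulrA.
Qed.

HB.instance Definition _ := GRing.Lmodule_isLalgebra.Build F A galg_scaleAl.

Fact galg_scaleAr (a : F) f g : a *: (f * g) = f * (a *: g).
Proof.
apply: galgP => x; rewrite galg_scaleE !galg_mulE mulr_sumr.
by apply: eq_bigr => y _; rewrite galg_scaleE mulrCA.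
Qed.

HB.instance Definition _ := GRing.Lalgebra_isAlgebra.Build F A galg_scaleAr.

HB.instance Definition _ := Algebra_isFalgebra.Build F A.

Definition galg_supp f : {set gT} := [set x | galg_fun f x != 0].

Definition left_ideal f : {vspace A} := ({:A} * <[f]>)%VS.

Lemma left_idealP f h : reflect (exists g, h = g * f) (h \in left_ideal f).
Proof.
rewrite /left_ideal -limg_amulr; apply: (iffP memv_imgP) => [[g _ ->]|[g ->]].
  by exists g; rewrite lfunE.
by exists g; rewrite ?memvf // lfunE.
Qed.

End GroupAlgebra.

Coercion galg_fun : galg >-> Funclass.

(* For an element a of order p: the sum of the f(a^i) z^i for 0 <= i < p. *)
Definition galg_poly (F : fieldType) (gT : finGroupType) (a : gT) (p : nat)
  (f : galg F gT) : {poly F} := \poly_(i < p) f (a ^+ i)%g.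

(* Main.v *)
(* The left ideal generated by f corresponds, in C[z]/(z^p - 1), to the       *)
(* multiples of g = gcd(f~, z^p - 1), so its dimension is p - deg g, and the   *)
(* theorem amounts to deg g < |supp f|: a nonzero polynomial of degree < p     *)
(* has fewer p-th roots of unity as roots than it has terms (Chebotarev).      *)
(* Following Frenkel, the coefficients may be taken in Z[x], with w in place   *)
(* of x, and not all divisible by p: the conditions are linear over Q(w).      *)
(* Dividing by prod_a (T - x^a) leaves a remainder divisible by Phi_p, and     *)
(* modulo p one has Phi_p = (x - 1)^(p-1). Once the powers of x - 1 common to  *)
(* all coefficients are removed, x = 1 gives a nonzero polynomial over F_p of  *)
(* degree < p, with no new term, divisible by (T - 1)^k for k the number of    *)
(* roots; such a polynomial has more than k terms, by differentiation.         *)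

From HB Require Import structures.
Require Import Defs.
From mathcomp Require Import all_boot all_order all_algebra all_fingroup.
From mathcomp Require Import all_field.
From mathcomp Require Import cyclic zify.

Import GRing.Theory.
Local Open Scope ring_scope.
Local Open Scope complex_scope.

(** The dimension count is [dim_left_ideal], the bound on the gcd is [size_gcdp_Xn_sub_1_lt_nterms],
    and its core is [prime_unity_roots_lt_nterms]. Modulo [p] all [p]-th roots of unity collapse to
    1, so a count of distinct roots becomes a multiplicity at 1, which [multiplicity1_lt_nterms]
    bounds by the number of terms. [kernel_descent] and [rat_matrix_primitive] supply coefficients
    for which reduction modulo [p] makes sense and is nonzero; [roots_mod_lt_nterms] handles the
    case where they still all vanish at x = 1. *)

(** * Multiplicity at 1 against number of terms in characteristic [p] *)

(** A nonzero constant term is lost on differentiating, while the multiplicity at 1 drops by at most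
    one; a zero constant term allows division by ['X], which is coprime to ['X - 1]. Both lower the
    degree. *)
Lemma multiplicity1_lt_nterms (K : fieldType) (p : nat) (n k : nat)
    (h : {poly K}) :
  p \in [pchar K] -> (n <= p)%N -> (size h <= n)%N -> h != 0 ->
  ('X - 1) ^+ k %| h -> (k < \sum_(i < n) (h`_i != 0)%R)%N.
Proof.
move=> charK; elim: n k h => [|n IHn] k h le_np le_hn h0 dvd_h.
  by move: le_hn; rewrite leqn0 size_poly_eq0 (negPf h0).
rewrite big_ord_recl /=; have [c0|c0] := eqVneq h`_0 0; last first.
  case: k dvd_h => [//|k] dvd_h; rewrite add1n ltnS.
  have dvd_h' : ('X - 1) ^+ k %| h^`().
    have [q ->] := dvdpP _ _ dvd_h; rewrite derivM deriv_exp derivB derivX.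
    rewrite derivC subr0 mul1r /= exprS dvdp_addr ?dvdp_mull //.
    by rewrite -mulr_natl dvdp_mull.
  have h'0 : h^`() != 0.
    apply: contraNneq c0 => /polyP dh0.
    have hC : h = (h`_0)%:P.
      apply/polyP => -[|i]; rewrite coefC //=.
      have [lt_in|le_ni] := ltnP i.+1 n.+1; last first.
        by rewrite nth_default // (leq_trans le_hn).
      (* Here [0 < i.+1 < p], so the factor [i.+1] brought down by the derivative is nonzero in
         [K]. *)
      have := dh0 i; rewrite coef_deriv coef0 -mulr_natr => /eqP.
      rewrite mulf_eq0 -(dvdn_pcharf charK) gtnNdvd ?orbF //; first by move/eqP.
      exact: leq_trans lt_in le_np.
    have : root h 1.
      rewrite root_factor_theorem; apply: dvdp_trans dvd_h.
      by rewrite exprS dvdp_mulr.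
    by rewrite {1}hC rootC.
  have le_h'n : (size h^`() <= n)%N.
    by rewrite -ltnS (leq_trans (lt_size_deriv h0)).
  apply: leq_trans (IHn k _ (ltnW le_np) le_h'n h'0 dvd_h') _.
  apply: leq_sum => i _; rewrite /bump leq0n add1n coef_deriv.
  have [->|_] := eqVneq h`_i.+1 0; last exact: leq_b1.
  by rewrite mul0rn eqxx.
have /factor_theorem[q Dh] : root h 0 by rewrite rootE horner_coef0 c0.
rewrite subr0 in Dh.
have q0 : q != 0 by apply: contraNneq h0 => q0; rewrite Dh q0 mul0r.
rewrite add0n (eq_bigr (fun i : 'I_n => nat_of_bool (q`_i != 0))); last first.
  by move=> i _; rewrite /bump leq0n add1n Dh coefMX.
apply: IHn => //; first exact: ltnW.
  by move: le_hn; rewrite Dh size_mulX.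
move: dvd_h; rewrite Dh Gauss_dvdpl //.
apply: coprimep_expl; rewrite -[X in coprimep _ X]subr0.
by rewrite coprimep_XsubC rootE !hornerE oppr_eq0 oner_eq0.
Qed.

Lemma dvdp_XsubC_map_horner (K : fieldType) (c : K) (F : {poly {poly K}}) :
  map_poly (horner_eval c) F = 0 ->
  exists F' : {poly {poly K}}, F = ('X - c%:P)%:P * F'.
Proof.
move=> Fc0; exists (\poly_(i < size F) (F`_i %/ ('X - c%:P))).
apply/polyP => i; rewrite coefCM coef_poly; case: ltnP => [_|le_Fi]; last first.
  by rewrite mulr0 nth_default.
rewrite mulrC divpK // -root_factor_theorem rootE.
by have /polyP/(_ i) := Fc0; rewrite coef_map coef0 => /eqP.
Qed.

(* Instantiated with F the reduction modulo p of a polynomial over Z[x]; the  *)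
(* last summand is the remainder modulo Phi_p. If F vanishes at x = 1 then so  *)
(* does G, and x - 1 cancels from the whole equation.                          *)
Lemma roots_mod_lt_nterms (K : fieldType) (p m : nat) (s : seq nat)
    (F G H : {poly {poly K}}) :
  p \in [pchar K] -> (size F <= p)%N -> F != 0 ->
  (forall i, (size (F`_i)%R <= m)%N) ->
  F = (\prod_(a <- s) ('X - ('X^a)%:P)) * G + (('X - 1) ^+ m)%:P * H ->
  (size s < \sum_(i < p) (F`_i != 0)%R)%N.
Proof.
(* [m] bounds the coefficient sizes as well as being the exponent of x - 1; cancelling x - 1 lowers
   both, and at 0 the bound would force [F = 0]. *)
move=> charK le_Fp; elim: m F G H le_Fp => [|m IHm] F G H le_Fp F0 le_Fm DF.
  case/eqP: F0; apply/polyP => i; apply/eqP.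
  by rewrite coef0 -size_poly_eq0 -leqn0.
pose P := \prod_(a <- s) ('X - ('X^a)%:P) : {poly {poly K}}.
pose ev1 := map_poly (horner_eval (1 : K)).
have evP : ev1 P = ('X - 1) ^+ size s.
  rewrite /ev1 /P rmorph_prod /= (eq_bigr (fun _ => 'X - 1)) => [|a _].
    by rewrite big_const_seq count_predT -Monoid.iteropE.
  by rewrite rmorphB /= map_polyX map_polyC /= /horner_eval hornerXn expr1n.
have evX m' : ev1 (('X - 1) ^+ m'.+1)%:P = 0.
  by rewrite /ev1 map_polyC /= /horner_eval !hornerE subrr expr0n.
have evF : ev1 F = ('X - 1) ^+ size s * ev1 G.
  have -> : ev1 F = ev1 P * ev1 G + ev1 (('X - 1) ^+ m.+1)%:P * ev1 H.
    by rewrite DF /ev1 rmorphD !rmorphM.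
  by rewrite evP evX mul0r addr0.
have [F1|F1] := eqVneq (ev1 F) 0; last first.
  have le_evF : (size (ev1 F) <= p)%N := leq_trans (size_poly _ _) le_Fp.
  have := @multiplicity1_lt_nterms K p p (size s) (ev1 F)
    charK (leqnn p) le_evF F1.
  rewrite {1}evF dvdp_mulr // => /(_ isT) /leq_trans; apply.
  apply: leq_sum => i _; rewrite /ev1 coef_map.
  have [->|_] := eqVneq F`_i 0; last exact: leq_b1.
  by rewrite raddf0 eqxx.
(* At x = 1 the product becomes a power of T - 1, which is not a zero divisor, and the [H] term
   vanishes. *)
have G1 : ev1 G = 0.
  move/esym/eqP: evF; rewrite F1 mulf_eq0 expf_eq0 polyXsubC_eq0 andbF.
  by move/eqP.
have [F' DF'] := @dvdp_XsubC_map_horner K 1 F F1.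
have [G' DG'] := @dvdp_XsubC_map_horner K 1 G G1.
have X1 : ('X - 1%:P)%:P != 0 :> {poly {poly K}}.
  by rewrite polyC_eq0 polyXsubC_eq0.
have F'0 : F' != 0 by apply: contraNneq F0 => F'0; rewrite DF' F'0 mulr0.
have cF i : F`_i = ('X - 1%:P) * F'`_i by rewrite DF' coefCM.
rewrite (eq_bigr (fun i : 'I_p => nat_of_bool (F'`_i != 0))); last first.
  by move=> i _; rewrite cF mulf_eq0 polyXsubC_eq0.
apply: (IHm F' G' H) => // [|i|].
- by move: le_Fp; rewrite DF' mul_polyC size_scale ?polyXsubC_eq0 //.
- have [->|c0] := eqVneq F'`_i 0; first by rewrite size_poly0.
  have := le_Fm i; rewrite cF size_mul ?polyXsubC_eq0 // size_XsubC.
  by [].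
apply: (mulfI X1); rewrite -DF' DF DG' mulrDr mulrCA; congr (_ + _).
by rewrite exprS polyCM mulrA.
Qed.

(** * Cyclotomic polynomials *)

Lemma prime_Cyclotomic (p : nat) :
  prime p -> ('X - 1) * 'Phi_p = 'X^p - 1 :> {poly int}.
Proof.
move=> pr_p; rewrite -prod_Cyclotomic ?prime_gt0 //.
have ->: divisors p = [:: 1%N; p].
  apply: (irr_sorted_eq ltn_trans ltnn) => [||d].
  - exact: sorted_divisors_ltn.
  - by rewrite /= prime_gt1.
  rewrite -dvdn_divisors ?prime_gt0 // !inE; apply/idP/idP.
    by case/primeP: pr_p => _ H /H.
  by case/orP => /eqP ->; rewrite ?dvd1n ?dvdnn.
rewrite !big_cons big_nil mulr1; congr (_ * _).
rewrite -['X]/('X^1) -(@prod_Cyclotomic 1) //.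
by rewrite -[divisors 1]/[:: 1%N] big_seq1.
Qed.

Lemma root_prime_Cyclotomic (R : numDomainType) (p : nat) (w : R) :
  prime p -> p.-primitive_root w -> root (map_poly intr 'Phi_p) w.
Proof.
move=> pr_p prim_w.
have : root (map_poly intr (('X - 1) * 'Phi_p : {poly int})) w.
  rewrite prime_Cyclotomic // rmorphB /= map_polyXn rmorph1 rootE !hornerE.
  by rewrite (prim_expr_order prim_w) subrr.
rewrite rmorphM rootM rmorphB /= map_polyX rmorph1 rootE !hornerE subr_eq0.
case/orP => // w1.
by have := prim_order_dvd prim_w 1; rewrite expr1 w1 dvdn1 gtn_eqF ?prime_gt1.
Qed.

(** Irreducibility of ['Phi_n] over the rationals is drawn from its being a minimal polynomial in
    [algC], and carried to [C] through the gcd: were the gcd with [r] constant, [w] could not be a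
    common root. Gauss's lemma brings the quotient back to the integers. *)
Lemma Cyclotomic_dvd_root (C : numFieldType) (n : nat) (w : C)
    (r : {poly int}) :
  root (map_poly intr 'Phi_n) w -> root (map_poly intr r) w ->
  exists q, r = 'Phi_n * q.
Proof.
case: n => [|n]; first by rewrite Cyclotomic0 rmorph1 rootC oner_eq0.
set f := 'Phi__; move=> fw rw.
suff : map_poly (intr : int -> rat) f %| map_poly intr r.
  rewrite dvdp_rat_int => /dvdpP_int[q ->]; exists q.
  by rewrite zprimitive_monic ?Cyclotomic_monic.
set fQ := map_poly intr f; set rQ := map_poly intr r.
have [z prim_z] := C_prim_root_exists (ltn0Sn n).
have dv_f q : root (map_poly (ratr : rat -> algC) q) z = (fQ %| q).
  have [f' [Df' _] ->] := minCpolyP z; congr (_ %| _).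
  apply: (map_inj_poly (fmorph_inj (ratr : rat -> algC)) (rmorph0 _)).
  rewrite -Df' (minCpoly_cyclotomic prim_z) -(Cintr_Cyclotomic prim_z).
  by rewrite -map_poly_comp; apply: eq_map_poly => c /=; rewrite ratr_int.
have f0 : fQ != 0 by rewrite monic_neq0 ?monic_map ?Cyclotomic_monic.
have /dvdpP[e De] := dvdp_gcdl fQ rQ.
have : root (map_poly (ratr : rat -> algC) fQ) z by rewrite dv_f.
rewrite {1}De rmorphM rootM !dv_f => /orP[dv_e|]; last first.
  by move/dvdp_trans; apply; apply: dvdp_gcdr.
have [e0 d0] : e != 0 /\ gcdp fQ rQ != 0.
  by apply/andP; rewrite -negb_or -mulf_eq0 -De.
have : coprimep fQ rQ.
  rewrite /coprimep eqn_leq; have := dvdp_leq e0 dv_e.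
  rewrite {1}De size_mul // lt0n size_poly_eq0 d0 andbT.
  have := d0; rewrite -size_poly_eq0; case: (size _) => // d _.
  by rewrite addnS /= -{2}[size e]addn0 leq_add2l.
rewrite -(coprimep_map (ratr : rat -> C)).
have ratr_intr q :
    map_poly (ratr : rat -> C) (map_poly intr q) = map_poly intr q.
  by rewrite -map_poly_comp; apply: eq_map_poly => c /=; rewrite ratr_int.
rewrite !ratr_intr => /coprimep_root/(_ fw)/negP[].
by rewrite -rootE.
Qed.

(** * Descent to integer coefficients and reduction modulo [p] *)

(** The evaluated matrix has entries in the subfield F(w), and row freeness is insensitive to field
    extension, so a nonzero kernel vector already exists over F(w); its entries are then written as
    polynomials in [w]. *)
Lemma kernel_descent (F C : fieldType) (iota : {rmorphism F -> C}) (w : C)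
    (P : {poly F}) (m n : nat) (A : 'M[{poly F}]_(m, n)) (h : 'rV[C]_m) :
  let ev q := (map_poly iota q).[w] in
  P != 0 -> root (map_poly iota P) w -> h != 0 -> h *m map_mx ev A = 0 ->
  exists2 u : 'rV[{poly F}]_m,
    u != 0 /\ (forall i, (size (u ord0 i) < size P)%N /\
                (ev (u ord0 i) = 0 -> u ord0 i = 0)) &
    map_mx ev u *m map_mx ev A = 0.
Proof.
move=> ev P0 Pw h0 hA.
pose inj : {rmorphism subFExtend iota w P -> C} := @subfx_inj F C iota w P.
pose eval := subfx_eval iota w P.
have injE q : inj (eval q) = ev q by exact: subfx_inj_eval.
have injA : map_mx inj (map_mx eval A) = map_mx ev A.
  by apply/matrixP => i j; rewrite !mxE injE.
have /rowV0Pn[v /sub_kermxP vA v0] : kermx (map_mx eval A) != 0.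
  rewrite kermx_eq0 -(row_free_map inj) injA.
  by apply: contraNN h0 => freeA; rewrite -(mulmx_free_eq0 _ freeA) hA.
have rep x : {q | x = eval q} by apply: sig_eqW; apply: subfxE.
(* [P] need not be minimal for [w], so a remainder modulo [P] can represent 0 without being 0; the
   case split makes the lift of 0 vanish. *)
pose lift x := if x == 0 then 0 else sval (rep x) %% P.
have ev_lift x : ev (lift x) = inj x.
  rewrite /lift; have [->|_] := eqVneq x 0.
    by rewrite /ev !rmorph0 horner0.
  case: (rep x) => q Dx /=; rewrite [in RHS]Dx injE [in RHS](divp_eq q P) /ev.
  by rewrite rmorphD rmorphM /= hornerD hornerM (rootP Pw) mulr0 add0r.
have inj0 x : inj x = 0 -> x = 0.
  by move/eqP; rewrite fmorph_eq0 => /eqP.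
exists (map_mx lift v).
  split.
    apply: contraNneq v0 => /matrixP u0; apply/eqP/matrixP => i j.
    rewrite [RHS]mxE; apply: inj0; rewrite -ev_lift.
    have := u0 i j; rewrite !mxE => ->.
    by rewrite /ev rmorph0 horner0.
  move=> i; rewrite mxE; split.
    rewrite /lift; case: eqP => _; last by rewrite ltn_modp.
    by rewrite size_poly0 lt0n size_poly_eq0.
  by rewrite ev_lift => /inj0 ->; rewrite /lift eqxx.
have -> : map_mx ev (map_mx lift v) = map_mx inj v.
  by apply/matrixP => i j; rewrite !mxE ev_lift.
by rewrite -injA -map_mxM vA map_mx0.
Qed.

(** The matrix is flattened into a polynomial so that the primitive part of an integer polynomial
    does the work. *)
Lemma rat_matrix_primitive (d m n : nat) (A : 'M[rat]_(m, n)) :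
  (1 < d)%N -> A != 0 ->
  exists (c : rat) (B : 'M[int]_(m, n)),
    [/\ c != 0, A = c *: map_mx intr B & exists i j, ~~ (d %| B i j)%Z].
Proof.
move=> d1 A0; have [q [a a0 Dq]] := rat_poly_scale (rVpoly (mxvec A)).
have q0 : q != 0.
  apply: contraNneq A0 => q0; rewrite -mxvec_eq0 -[mxvec A]rVpolyK Dq q0.
  by rewrite rmorph0 scaler0 linear0.
have le_q : (size q <= m * n)%N.
  rewrite -(size_rat_int_poly q) -(size_scale (a := a%:~R^-1)) -?Dq.
    exact: size_poly.
  by rewrite invr_eq0 intr_eq0.
have DB i j : vec_mx (poly_rV (zprimitive q)) i j =
    (zprimitive q)`_(mxvec_index i j).
  by rewrite !mxE.
exists (a%:~R^-1 * (zcontents q)%:~R), (vec_mx (poly_rV (zprimitive q))); split.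
- by rewrite mulf_neq0 ?invr_eq0 ?intr_eq0 ?zcontents_eq0.
- apply/matrixP => i j.
  rewrite [LHS](_ : _ = (rVpoly (mxvec A))`_(mxvec_index i j)).
    rewrite Dq [in LHS](zpolyEprim q) coefZ coef_map coefZ /= rmorphM mulrA.
    by rewrite !mxE.
  by rewrite coef_rVpoly_ord mxvecE.
have : ~~ (d %| zcontents (zprimitive q))%Z.
  by rewrite zcontents_primitive q0 dvdzE /= dvdn1 gtn_eqF.
rewrite dvdz_contents => /allPn[_ /(nthP 0)[k + <-]].
rewrite size_zprimitive => lt_kq.
have lt_k := leq_trans lt_kq le_q; rewrite -[k]/(nat_of_ord (Ordinal lt_k)).
by case: (mxvec_indexP (Ordinal lt_k)) => i j ndvd; exists i, j; rewrite DB.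
Qed.

(** Frobenius gives ['X^p - 1 = ('X - 1) ^+ p] over ['F_p]; one factor cancels. *)
Lemma mod_prime_Cyclotomic (p : nat) :
  prime p -> map_poly intr 'Phi_p = ('X - 1) ^+ p.-1 :> {poly 'F_p}.
Proof.
move=> pr_p; have X1 : 'X - 1 != 0 :> {poly 'F_p} by rewrite polyXsubC_eq0.
apply: (mulfI X1); rewrite -exprS prednK ?prime_gt0 //.
have -> : 'X - 1 = map_poly intr ('X - 1 : {poly int}) :> {poly 'F_p}.
  by rewrite rmorphB rmorph1 /= map_polyX.
rewrite -rmorphM prime_Cyclotomic // -!rmorphXn.
have charP : p \in [pchar {poly 'F_p}] by rewrite pchar_poly pchar_Fp.
rewrite rmorphB rmorph1 /= map_polyXn rmorphXn rmorphB rmorph1 /= map_polyX.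
rewrite -!(pFrobenius_autE charP) pFrobenius_autB_comm ?pFrobenius_aut1 //.
exact: mulrC.
Qed.

(** * Roots of unity against number of terms *)

Lemma prime_unity_roots_lt_nterms (C : numFieldType) (p : nat) (w : C)
    (h : {poly C}) (s : seq nat) :
  prime p -> p.-primitive_root w -> (size h <= p)%N -> h != 0 ->
  uniq [seq w ^+ a | a <- s] -> all (root h) [seq w ^+ a | a <- s] ->
  (size s < \sum_(i < p) (h`_i != 0)%R)%N.
Proof.
move=> pr_p prim_w le_hp h0 uniq_s root_s.
have Phi_w : root (map_poly intr 'Phi_p) w by apply: root_prime_Cyclotomic.
have ratr_intr q :
    map_poly (ratr : rat -> C) (map_poly intr q) = map_poly intr q.
  by rewrite -map_poly_comp; apply: eq_map_poly => c /=; rewrite ratr_int.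
pose ev : {rmorphism {poly rat} -> C} :=
  horner_eval w \o map_poly (ratr : rat -> C).
pose evz : {rmorphism {poly int} -> C} := horner_eval w \o map_poly intr.
pose hv : 'rV[C]_p := poly_rV h.
(* The diagonal block forces a kernel vector to vanish wherever h does. *)
pose A : 'M[{poly rat}]_(p, size s + p) :=
  row_mx (\matrix_(i, k) 'X^(nth 0%N s k * i))
         (diag_mx (\row_i ((h`_i == 0)%:R)%:P)).
have kerA (v : 'rV[C]_p) : v *m map_mx ev A = 0 <->
    (forall k : 'I_(size s), \sum_i v ord0 i * w ^+ (nth 0%N s k * i) = 0) /\
    (forall i : 'I_p, h`_i = 0 -> v ord0 i = 0).
  rewrite /A map_row_mx mul_mx_row map_diag_mx mul_mx_diag.
  have evX n : ev 'X^n = w ^+ n by rewrite /= map_polyXn /horner_eval hornerXn.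
  split=> [/eqP|[v1 v2]].
    rewrite row_mx_eq0 => /andP[/eqP/matrixP v1 /eqP/matrixP v2]; split=> i.
      have := v1 ord0 i; rewrite !mxE => v1i; rewrite -[RHS]v1i.
      apply: eq_bigr => j _.
      by rewrite !mxE evX.
    move=> hi0; have := v2 ord0 i; rewrite !mxE hi0 eqxx.
    by rewrite rmorph1 mulr1.
  apply/eqP; rewrite row_mx_eq0; apply/andP; split; apply/eqP/matrixP => i j.
    rewrite !mxE ord1 -[RHS](v1 j); apply: eq_bigr => k _.
    by rewrite !mxE evX.
  rewrite !mxE ord1; have [/v2 ->|_] := eqVneq h`_j 0; first by rewrite mul0r.
  by rewrite !rmorph0 mulr0.
have [||||u [u0 uP] /kerA[uw uh]] := @kernel_descent _ C (ratr : rat -> C) w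
    (map_poly intr 'Phi_p) p (size s + p) A hv.
- by rewrite monic_neq0 ?monic_map ?Cyclotomic_monic.
- by rewrite ratr_intr.
- by apply: contraNneq h0 => hv0; rewrite -(poly_rV_K le_hp) -/hv hv0 linear0.
- apply/kerA; split=> [k|i hi]; last by rewrite mxE.
  have /(all_nthP 0)/(_ k) := root_s.
  rewrite size_map => /(_ (ltn_ord k))/rootP; rewrite (nth_map 0%N) //.
  rewrite (horner_coef_wide _ le_hp) => hk; rewrite -[RHS]hk.
  apply: eq_bigr => i _.
  by rewrite mxE exprM.
pose U : 'M[rat]_(p, p.-1) := \matrix_(i, j) (u ord0 i)`_j.
have size_u i : (size (u ord0 i) <= p.-1)%N.
  have [+ _] := uP i; rewrite size_rat_int_poly size_Cyclotomic.
  by rewrite totient_prime.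
have rowU i : rVpoly (row i U) = u ord0 i.
  rewrite -[RHS](poly_rV_K (size_u i)); congr rVpoly.
  by apply/rowP => j; rewrite !mxE.
have U0 : U != 0.
  apply: contraNneq u0 => U0; apply/eqP/rowP => i.
  by rewrite -rowU U0 row0 linear0 mxE.
have [c [B [c0 DU [i0 [j0 ndvdB]]]]] :=
  rat_matrix_primitive _ _ _ _ (prime_gt1 pr_p) U0.
pose v i := rVpoly (row i B).
have Du i : u ord0 i = c *: map_poly intr (v i).
  rewrite -rowU DU map_rVpoly -linearZ; congr rVpoly.
  by apply/rowP=> j; rewrite !mxE.
have ev_u i : ev (u ord0 i) = ratr c * evz (v i).
  by rewrite Du /= map_polyZ /horner_eval hornerZ ratr_intr.
pose F : {poly {poly int}} :=
  \poly_(i < p) (if insub i is Some i then v i else 0).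
have coefF (i : 'I_p) : F`_i = v i by rewrite coef_poly ltn_ord valK.
pose P : {poly {poly int}} := \prod_(a <- s) ('X - ('X^a)%:P).
have monP : P \is monic by apply: monic_prod => a _; apply: monicXsubC.
have DF := Pdiv.RingMonic.rdivp_eq monP F.
set Q := Pdiv.Ring.rdivp F P in DF; set R := Pdiv.Ring.rmodp F P in DF.
have evP : map_poly evz P = \prod_(z <- [seq w ^+ a | a <- s]) ('X - z%:P).
  rewrite rmorph_prod big_map; apply: eq_bigr => a _.
  by rewrite rmorphB /= map_polyX map_polyC /= map_polyXn /horner_eval hornerXn.
(* At x = w the remainder has degree below [size s], yet vanishes at the [size s] distinct points
   [w ^+ a], because [F] and [P] do. *)
have evR0 : map_poly evz R = 0.
  apply: (@roots_geq_poly_eq0 _ _ [seq w ^+ a | a <- s]) => //.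
    apply/allP => z z_s; rewrite rootE.
    have -> : map_poly evz R = map_poly evz F - map_poly evz Q * map_poly evz P.
      by rewrite [in map_poly evz F]DF rmorphD rmorphM addrAC subrr add0r.
    have Pz : root (map_poly evz P) z by rewrite evP root_prod_XsubC.
    rewrite hornerD hornerN hornerM (rootP Pz) mulr0 subr0.
    have le_evF : (size (map_poly evz F) <= p)%N.
      exact: leq_trans (size_poly _ _) (size_poly _ _).
    rewrite (horner_coef_wide _ le_evF).
    have {z z_s Pz}/(nthP 0)[k + <-] := z_s; rewrite size_map => lt_k.
    rewrite (nth_map 0%N) //; have := uw (Ordinal lt_k).
    rewrite (eq_bigr (fun i => ratr c * (evz (v i) * w ^+ (nth 0%N s k * i))));
      last by move=> i _; rewrite mxE mulrA -ev_u.
    rewrite -mulr_sumr => /eqP; rewrite mulf_eq0 fmorph_eq0 (negPf c0) /=.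
    congr (_ == 0); apply: eq_bigr => i _.
    by rewrite coef_map coefF exprM.
  rewrite size_map; apply: leq_trans (size_poly _ _) _.
  rewrite -ltnS -(size_prod_XsubC _ (fun a => 'X^a : {poly int})).
  exact/Pdiv.Ring.ltn_rmodpN0/monic_neq0.
pose red : {rmorphism {poly int} -> {poly 'F_p}} := map_poly intr.
have redR j : ('X - 1) ^+ p.-1 %| red R`_j.
  have [|q ->] := @Cyclotomic_dvd_root C p w R`_j Phi_w.
    by rewrite rootE; have /polyP/(_ j) := evR0; rewrite coef_map coef0 => /eqP.
  by rewrite rmorphM /= mod_prime_Cyclotomic // dvdp_mulr.
have [H DH] : exists H, map_poly red R = (('X - 1) ^+ p.-1)%:P * H.
  exists (\poly_(j < size R) (red R`_j %/ ('X - 1) ^+ p.-1)).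
  apply/polyP => j; rewrite coef_map coefCM coef_poly.
  case: ltnP => [_|le_Rj]; first by rewrite mulrC divpK.
  by rewrite (nth_default 0 le_Rj) raddf0 mulr0.
(* The exponent [p.-1] of x - 1 in ['Phi_p] modulo [p] is also the size bound on the coefficients of
   [F], as the induction requires; primitivity of [B] keeps the reduction of [F] nonzero. *)
have : (size s < \sum_(i < p) ((map_poly red F)`_i != 0)%R)%N.
  apply: (@roots_mod_lt_nterms _ p p.-1 s _ (map_poly red Q) H).
  - exact: pchar_Fp.
  - exact: leq_trans (size_poly _ _) (size_poly _ _).
  - apply: contraNneq ndvdB => /polyP/(_ i0); rewrite coef_map coefF coef0.
    move/polyP/(_ j0); rewrite coef_map coef_rVpoly_ord mxE coef0 => /eqP.
    by rewrite -(dvdz_pcharf (pchar_Fp pr_p)).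
  - move=> i; rewrite coef_map; apply: leq_trans (size_poly _ _) _.
    rewrite coef_poly; case: ltnP => [lt_ip|_]; last by rewrite size_poly0.
    by rewrite (insubT (fun j => j < p)%N lt_ip) size_poly.
  have -> : map_poly red F = map_poly red Q * map_poly red P + map_poly red R.
    by rewrite [in LHS]DF rmorphD rmorphM.
  rewrite DH mulrC; congr (_ * _ + _).
  rewrite rmorph_prod; apply: eq_bigr => a _.
  by rewrite rmorphB /= map_polyX map_polyC /= map_polyXn.
move/leq_trans; apply; apply: leq_sum => i _; rewrite coef_map coefF.
(* No new term appears: where [h] has coefficient 0, [u] vanishes at [w], hence is the zero
   polynomial by the choice of lifts. *)
have [hi0|_] := eqVneq h`_i 0; last exact: leq_b1.
have vi0 : v i = 0.
  have := uh i hi0; rewrite mxE => /(proj2 (uP i)); rewrite Du => /eqP.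
  rewrite scaler_eq0 (negPf c0) -size_poly_eq0 size_rat_int_poly size_poly_eq0.
  by move/eqP.
by rewrite vi0 raddf0 eqxx.
Qed.

(** * The group algebra of a cyclic group as F[z]/(z^n - 1) *)

Definition galg_delta (F : fieldType) (gT : finGroupType) (x : gT) :
    galg F gT :=
  [ffun y => (y == x)%:R : F^o].

Lemma galg_deltaX (F : fieldType) (gT : finGroupType) (x : gT) (i : nat) :
  galg_delta F gT x ^+ i = galg_delta F gT (x ^+ i)%g.
Proof.
elim: i => [|i IHi]; first by rewrite expr0 expg0.
apply: galgP => y; rewrite exprSr {}IHi galg_mulE (bigD1 (x ^+ i)%g) //=.
rewrite {1 2}/galg_fun !ffunE eqxx mul1r big1 ?addr0 => [|z /negPf zx].
  by rewrite /galg_fun ffunE expgSr (canF_eq (mulKVg _)).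
by rewrite /galg_fun !ffunE zx mul0r.
Qed.

(** Substituting the basis element of [x] for z simply copies coefficients below degree [#[x]],
    since the powers of [x] involved are distinct. *)
Lemma galg_ev_coef (F : fieldType) (gT : finGroupType) (x : gT) (q : {poly F})
    (i : nat) :
  (size q <= #[x]%g)%N -> (i < #[x]%g)%N ->
  galg_fun (horner_alg (galg_delta F gT x) q) (x ^+ i)%g = q`_i.
Proof.
move=> le_q lt_i; rewrite -[q in LHS]coefK poly_def linear_sum /=.
have -> (r : seq 'I_(size q)) (E : 'I_(size q) -> galg F gT) y :
    galg_fun (\sum_(j <- r) E j) y = \sum_(j <- r) galg_fun (E j) y.
  by apply: (big_morph (fun h => galg_fun h y)) => [h k|];
    rewrite ?galg_addE ?galg_zeroE.
under eq_bigr => j _.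
  rewrite linearZ_LR rmorphXn /= horner_algX galg_deltaX mulr_algl galg_scaleE.
  rewrite /galg_fun ffunE eq_expg_mod_order.
  rewrite !modn_small ?(leq_trans (ltn_ord j)) //.
  over.
have [lt_iq|le_qi] := ltnP i (size q); last first.
  rewrite nth_default // big1 // => j _.
  by rewrite gtn_eqF ?mulr0 // (leq_trans (ltn_ord j)).
rewrite (bigD1 (Ordinal lt_iq)) //= eqxx mulr1 big1 ?addr0 // => j ji.
by rewrite -[i in i == _]/(val (Ordinal lt_iq)) val_eqE eq_sym (negPf ji) mulr0.
Qed.

Lemma dim_left_ideal (F : fieldType) (gT : finGroupType) (x : gT)
    (f : galg F gT) :
  [set: gT] = <[x]>%g ->
  \dim (left_ideal f) =
    (#[x]%g - (size (gcdp (galg_poly x #[x]%g f) ('X^#[x]%g - 1))).-1)%N.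
Proof.
move=> genx; set n := #[x]%g; set f' := galg_poly x n f; set X1 := 'X^n - 1.
have n0 : (0 < n)%N := order_gt0 x.
set g := gcdp f' X1; set d := (size g).-1.
pose ev := horner_alg (galg_delta F gT x).
have sz_X1 : size X1 = n.+1 by rewrite size_XnsubC.
have X10 : X1 != 0 by rewrite -size_poly_gt0 sz_X1.
have g0 : g != 0 by rewrite gcdp_eq0 negb_and X10 orbT.
have sz_g : size g = d.+1 by rewrite prednK // size_poly_gt0.
have le_dn : (d <= n)%N by rewrite -ltnS -sz_g -sz_X1 dvdp_leq // dvdp_gcdr.
have evX1 : ev X1 = 0.
  rewrite /ev rmorphB rmorphXn /= rmorph1 horner_algX galg_deltaX expg_order.
  by rewrite subrr.
have ev_poly (h : galg F gT) : ev (galg_poly x n h) = h.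
  apply: galgP => y; have : y \in <[x]>%g by rewrite -genx inE.
  case/cyclePmin => i lt_i ->; rewrite /ev galg_ev_coef ?size_poly //.
  by rewrite coef_poly lt_i.
(* Multiples of [g] of degree below [n] are parametrised by cofactors with [n - d] coefficients; [T]
   will be injective with image the ideal. *)
pose T (v : 'rV[F]_(n - d)) : galg F gT := ev (rVpoly v * g).
have linT : linear T.
  move=> a u v; rewrite /T linearP mulrDl -scalerAl /ev -mul_polyC.
  by rewrite rmorphD rmorphM /= horner_algC mulr_algl.
pose TL : {linear 'rV[F]_(n - d) -> galg F gT} :=
  HB.pack T (GRing.isLinear.Build F 'rV[F]_(n - d) (galg F gT) _ T linT).
have size_rg (v : 'rV[F]_(n - d)) : (size (rVpoly v * g)%R <= n)%N.
  apply: leq_trans (size_polyMleq _ _) _; rewrite sz_g addnS /=.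
  by apply: leq_trans (leq_add (size_poly _ _) (leqnn d)) _; rewrite subnK.
have kerT : (lker (linfun TL) == 0)%VS.
  apply/lker0P => u v; rewrite !lfunE /= /T => Tuv.
  have: rVpoly u * g = rVpoly v * g.
    apply/polyP => i; have [lt_in|le_ni] := ltnP i n; last first.
      by rewrite !nth_default // (leq_trans (size_rg _)).
    by rewrite -!(galg_ev_coef _ _ x) // -/ev Tuv.
  by move/(mulIf g0)/(can_inj (@rVpolyK _ _)).
have imgT : left_ideal f = limg (linfun TL).
  apply/eqP; rewrite eqEsubv; apply/andP; split; apply/subvP => h.
    (* Since [g] divides both [f'] and [X1], it still divides the product after reduction modulo
       [X1]. *)
    case/left_idealP => k ->; pose m := galg_poly x n k * f' %% X1.
    have ev_m : ev m = k * f.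
      have := congr1 ev (divp_eq (galg_poly x n k * f') X1).
      by rewrite /ev rmorphM rmorphD rmorphM /= -/ev !ev_poly evX1 mulr0 add0r.
    have /dvdpP[e De] : g %| m.
      by rewrite -(dvdp_mod _ (dvdp_gcdr f' X1)) dvdp_mull // dvdp_gcdl.
    have le_e : (size e <= n - d)%N.
      have [->|e0] := eqVneq e 0; first by rewrite size_poly0.
      have : (size m < n.+1)%N by rewrite -sz_X1 ltn_modp.
      by rewrite De size_mul // sz_g addnS ltnS leq_subRL // addnC.
    apply/memv_imgP; exists (poly_rV e); first exact: memvf.
    by rewrite lfunE /= /T poly_rV_K // -De ev_m.
  case/memv_imgP => v _ ->; apply/left_idealP; rewrite lfunE /= /T.
  (* Conversely, Bezout writes [g] as a combination of [f'] and [X1], up to the scalars [c1] and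
     [c2], and evaluation kills the [X1] part. *)
  have [[a b] /= /eqpP[[c1 c2] /= /andP[c1_0 c2_0] Dg]] := Bezoutp f' X1.
  exists (ev (c2^-1 *: (c1 *: (rVpoly v * a)))).
  rewrite -[f]ev_poly -/f'.
  have -> : rVpoly v * g =
      c2^-1 *: (c1 *: (rVpoly v * a)) * f' +
      c2^-1 *: (c1 *: (rVpoly v * b)) * X1.
    rewrite -[g](scalerK c2_0) -Dg -!scalerAl -!scalerDr -!scalerAr.
    by rewrite -!mulrA -mulrDr.
  by rewrite /ev rmorphD !rmorphM /= -/ev evX1 mulr0 addr0.
rewrite imgT limg_dim_eq; last by rewrite (eqP kerT) capv0.
by rewrite dimvf /dim /= mul1n.
Qed.

Lemma card_galg_supp (F : fieldType) (gT : finGroupType) (x : gT)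
    (f : galg F gT) :
  [set: gT] = <[x]>%g ->
  #|galg_supp f| = (\sum_(i < #[x]%g) ((galg_poly x #[x]%g f)`_i != 0)%R)%N.
Proof.
move=> genx; have bij : bijective (fun i : 'I_#[x]%g => (x ^+ i)%g).
  apply: inj_card_bij => [i j /eqP|]; last by rewrite card_ord -cardsT genx.
  by rewrite eq_expg_ord // => /eqP.
rewrite -sum1_card (reindex _ (onW_bij _ bij)) big_mkcond /=.
by apply: eq_bigr => i _; rewrite inE coef_poly ltn_ord; case: eqP.
Qed.

(** * The degree of the gcd, and the theorem *)

Lemma closed_prim_root_exists (C : numClosedFieldType) (n : nat) :
  (0 < n)%N -> exists w : C, n.-primitive_root w.
Proof.
move=> n0; have [r Dr] := closed_field_poly_normal ('X^n - 1 : {poly C}).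
rewrite (monicP (monicXnsubC 1 n0)) scale1r in Dr.
have unity_r : all n.-unity_root r.
  by apply/allP => z; rewrite -root_prod_XsubC -Dr.
have lt_nr : (n < (size r).+1)%N.
  by rewrite -(size_prod_XsubC r id) -Dr size_XnsubC.
have [|w _ prim_w] := hasP (has_prim_root n0 unity_r _ lt_nr); last by exists w.
rewrite -separable_prod_XsubC -Dr separable_Xn_sub_1 //.
by rewrite Num.Theory.pnatr_eq0 -lt0n.
Qed.

(** ['X^p - 1] has distinct linear factors, so the degree of the gcd counts the [p]-th roots of
    unity that are roots of [h]. *)
Lemma size_gcdp_Xn_sub_1_lt_nterms (C : numClosedFieldType) (p : nat)
    (h : {poly C}) :
  prime p -> (size h <= p)%N -> h != 0 ->
  ((size (gcdp h ('X^p - 1))).-1 < \sum_(i < p) (h`_i != 0)%R)%N.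
Proof.
move=> pr_p le_hp h0.
have [w prim_w] := closed_prim_root_exists C p (prime_gt0 pr_p).
have /dvdp_prod_XsubC[m Dg] :
    gcdp h ('X^p - 1) %| \prod_(i <- index_iota 0 p) ('X - (w ^+ i)%:P).
  by rewrite (factor_Xn_sub_1 prim_w) dvdp_gcdr.
set s := mask m _ in Dg.
rewrite (eqp_size Dg) size_prod_XsubC.
apply: (prime_unity_roots_lt_nterms _ _ _ _ _ pr_p prim_w) => //.
  rewrite map_inj_in_uniq ?mask_uniq ?iota_uniq // => i j /mem_mask + /mem_mask.
  rewrite !mem_index_iota /= => lt_i lt_j /eqP.
  by rewrite (eq_prim_root_expr prim_w) !modn_small // => /eqP.
apply/allP => z z_s; have : root (gcdp h ('X^p - 1)) z.
  rewrite (eqp_root Dg).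
  rewrite -(big_map (fun i => w ^+ i) xpredT (fun c => 'X - c%:P)).
  by rewrite root_prod_XsubC.
by rewrite root_gcd => /andP[].
Qed.

Theorem lemma3p24 (R : realType) (p : nat) (gT : finGroupType) (alpha : gT)
    (f : galg R[i] gT) :
  prime p ->
  [set: gT] = <[alpha]>%g ->
  #|[set: gT]| = p ->
  f != 0 ->
  (p + 1 <= #|galg_supp f| + \dim (left_ideal f))%N
  /\ (#|galg_supp f| + \dim (left_ideal f) = p + 1 <->
      (size (gcdp (galg_poly alpha p f) ('X^p - 1))).-1
        = #|galg_supp f| - 1)%N.
Proof.
move=> pr_p gen card_p f0.
have ord_p : #[alpha]%g = p by rewrite orderE -gen.
have := card_galg_supp _ _ _ f gen; have := dim_left_ideal _ _ _ f gen.
rewrite ord_p => -> ->; set h := galg_poly alpha p f.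
have h0 : h != 0.
  apply: contraNneq f0 => h0; apply/eqP/galgP => y; rewrite galg_zeroE.
  have : y \in <[alpha]>%g by rewrite -gen inE.
  case/cyclePmin => i; rewrite ord_p => lt_ip ->.
  by have /polyP/(_ i) := h0; rewrite coef_poly lt_ip coef0.
have le_hp : (size h <= p)%N by apply: size_poly.
set g := gcdp h _; set S := (\sum_(i < p) _)%N.
have lt_gS : ((size g).-1 < S)%N :=
  size_gcdp_Xn_sub_1_lt_nterms _ _ _ pr_p le_hp h0.
have X1 : 'X^p - 1 != 0 :> {poly R[i]}.
  by rewrite monic_neq0 ?monicXnsubC ?prime_gt0.
have le_gp : (size g <= p.+1)%N.
  rewrite -(size_XnsubC (1 : R[i]) (prime_gt0 pr_p)).
  exact: dvdp_leq X1 (dvdp_gcdr _ _).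
(* With d the degree of [g], what remains is arithmetic on [S + (p - d)]; [d < S] and [d <= p]
   ensure that no subtraction is truncated. *)
clearbody S; move: (size g) lt_gS le_gp => n; lia.
Qed.
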